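(* Let $G$ be a finite group and let $C_1,\ldots,C_n$ be cosets (left or right) of subgroups of $G$ such that $A:=G\setminus(C_1\cup\ldots\cup C_n)\neq\varnothing$. Then $$|A|\ge\frac{|G|}{2^n}.$$
   Context: Different $C_i$ may be cosets of different subgroups. $n$ is a positive integer. *)

(* Defs.v *)
From mathcomp Require Import all_boot all_order all_algebra all_fingroup.

Set Implicit Arguments.
Unset Strict Implicit.
Unset Printing Implicit Defensive.

Local Open Scope group_scope.

(* [H] is existential, so the members of a family of such sets may be cosets
   of different subgroups. *)
Definition subgroup_coset (gT : finGroupType) (G : {group gT}) (C : {set gT}) : Prop :=
  exists2 H : {group gT}, H \subset G & C \in lcosets H G \/ C \in rcosets H G.

(* Main.v *)
Require Import Defs.
From mathcomp Require Import all_boot all_order all_algebra all_fingroup.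

(** Every [C i] is a left coset [g_i K_i].  Encode the left cosets of [K_i] by
    distinct rationals [c(-)] and consider the [G x G] matrix
    [M(y, s) = \prod_i (c(s K_i) - c(y g_i K_i))], whose [(y, s)] entry is nonzero
    exactly when [y^-1 s] lies in [A].  Expanding the product over the subsets of
    the index set factors [M] through dimension [2 ^ n], so [\rank M <= 2 ^ n].
    Every column of [M] has a nonzero entry, so the supports of [\rank M] rows
    spanning the row space cover [G]; each of these supports has at most [#|A|]
    elements. *)

Set Implicit Arguments.
Unset Strict Implicit.
Unset Printing Implicit Defensive.

Local Open Scope ring_scope.

Import Order.TTheory GRing.Theory Num.Theory.

Lemma leq_mxrank_row_support (F : fieldType) (m p a : nat) (M : 'M[F]_(m, p)) :
  (forall i, #|[set j | M i j != 0%R]| <= a)%N ->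
  (forall j, exists i, M i j != 0%R) ->
  (p <= \rank M * a)%N.
Proof.
move=> rowM colM; pose f := maxrankfun M.
have cover : [set: 'I_p] \subset \bigcup_k [set j | M (f k) j != 0].
  apply/subsetP => j _; apply/bigcupP.
  have [/existsP [k Mkj] | /existsPn noM] := boolP [exists k, M (f k) j != 0].
    by exists k; rewrite ?inE.
  (* Each row is a combination of the rows chosen by [f], so a column vanishing on those vanishes
     everywhere. *)
  have [i /negP[]] := colM j; apply/eqP.
  have /submxP [D /rowP /(_ j)] : (row i M <= rowsub f M)%MS.
    by rewrite eq_maxrowsub row_sub.
  rewrite !mxE => ->; apply: big1 => k _.
  by rewrite mxE (eqP (negPn (noM k))) mulr0.
have rank_sum : (\sum_(k < \rank M) #|[set j | M (f k) j != 0%R]| <= \rank M * a)%N.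
  rewrite -[leqRHS](congr1 (muln^~ a) (card_ord (\rank M))) -sum_nat_const.
  by apply: leq_sum.
have := leq_trans (subset_leq_card cover); rewrite cardsT card_ord; apply.
apply: leq_trans rank_sum; elim/big_rec2: _ => [|k s B _ leB].
  by rewrite cards0.
by rewrite (leq_trans (leq_card_setU _ _)) // leq_add2l.
Qed.

Lemma mxrank_prod_sub (F : fieldType) (n m p : nat)
    (u : 'I_m -> 'I_n -> F) (v : 'I_p -> 'I_n -> F) :
  (\rank (\matrix_(i, j) \prod_k (v j k - u i k))%R <= 2 ^ n)%N.
Proof.
(* [J] collects the factors from which the [v] term is taken; the signs go into [U]. *)
pose U := \matrix_(i < m, J < #|{set 'I_n}|)
  \prod_k (if k \in enum_val J then 1 else - u i k).
pose V := \matrix_(J < #|{set 'I_n}|, j < p)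
  \prod_k (if k \in enum_val J then v j k else 1).
suff -> : \matrix_(i, j) \prod_k (v j k - u i k) = U *m V.
  rewrite (leq_trans (mxrankM_maxl _ _)) // (leq_trans (rank_leq_col _)) //.
  by rewrite -cardsT -powersetT card_powerset cardsT card_ord.
apply/matrixP => i j; rewrite !mxE bigA_distr.
rewrite (reindex _ (onW_bij _ (enum_val_bij _))) /=.
apply: eq_big => [J|J _] //; rewrite !mxE -big_split /=.
by apply: eq_bigr => k _; case: ifP; rewrite ?mul1r ?mulr1.
Qed.

(** A right coset [H g] equals [g (g^-1 H g)], a left coset of a conjugate. *)
Lemma subgroup_coset_lcoset (gT : finGroupType) (G : {group gT}) (C : {set gT}) :
  subgroup_coset G C ->
  exists gK : gT * {group gT}, C = (gK.1 *: gK.2)%g.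
Proof.
case=> H sHG [/lcosetsP|/rcosetsP] [g _ ->]; first by exists (g, H).
by exists (g, H :^ g)%G; rewrite /= conjsgE -lcosetM mulgV lcoset1.
Qed.

Theorem mainTheorem2 (gT : finGroupType) (G : {group gT}) (n : nat)
    (C : 'I_n -> {set gT}) :
  (0 < n)%N ->
  (forall i : 'I_n, subgroup_coset G (C i)) ->
  let A := G :\: \bigcup_(i < n) C i in
  A != set0 ->
  (#|G|%:R / 2%:R ^+ n <= #|A|%:R :> rat).
Proof.
move=> _ cosC A /set0Pn [a0 Aa0].
have [gK defC] := fin_all_exists (fun i => subgroup_coset_lcoset (cosC i)).
pose c (B : {set gT}) : rat := (enum_rank B)%:R.
have c_inj : injective c.
  by move=> B D /eqP; rewrite eqr_nat => /eqP/val_inj/enum_rank_inj.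
pose M := \matrix_(y < #|G|, s < #|G|) \prod_i
  (c (enum_val s *: (gK i).2)%g - c (enum_val y * (gK i).1 *: (gK i).2)%g).
have M_neq0 y s : (M y s != 0) = ((enum_val y)^-1 * enum_val s \in A)%g.
  rewrite mxE inE groupM ?groupV ?enum_valP // andbT.
  (* Factor [i] vanishes iff [s K_i = y g_i K_i], that is, iff [y^-1 s] lies in [g_i K_i = C i]. *)
  apply/prodf_neq0/negP => [Mys /bigcupP [i _] | nC i _].
    rewrite defC -mem_lcoset -lcosetM => /lcoset_eqP eqs.
    by have := Mys i isT; rewrite eqs subrr eqxx.
  rewrite subr_eq0; apply/eqP => /c_inj /lcoset_eqP; rewrite lcosetM mem_lcoset.
  by rewrite -defC => Ci; case: nC; apply/bigcupP; exists i.
have card_row y : (#|[set s | M y s != 0%R]| <= #|A|)%N.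
  (* The injection [s |-> y^-1 s] sends the support of row [y] into [A]. *)
  rewrite -(card_imset _ (inj_comp (mulgI (enum_val y)^-1%g) enum_val_inj)).
  by apply/subset_leq_card/subsetP => _ /imsetP [s + ->]; rewrite inE M_neq0.
have col_neq0 s : exists y, M y s != 0.
  have Gs := enum_valP s; have Ga0 : a0 \in G by have /setDP[] := Aa0.
  have Gy : (enum_val s * a0^-1)%g \in G by rewrite groupM ?groupV.
  (* With [y = s a0^-1], one gets [y^-1 s = a0], which is in [A]. *)
  exists (enum_rank_in Gy (enum_val s * a0^-1)%g).
  by rewrite M_neq0 enum_rankK_in // invMg invgK mulgKV.
have leG : (#|G| <= 2 ^ n * #|A|)%N.
  apply: leq_trans (leq_mxrank_row_support card_row col_neq0) _.
  by rewrite leq_mul2r mxrank_prod_sub orbT.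
by rewrite ler_pdivrMr ?exprn_gt0 // -natrX -natrM ler_nat mulnC.
Qed.
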